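(* Let $A$ be an $n \times n$ real-valued matrix which is vertex-transitive. Then $\|A\|_{\mathsf G} = n\|A\|$.
   Context: For $A=(a_{st})_{s,t\in[n]}$, a permutation $\sigma$ of $[n]=\{1,\dots,n\}$ is an automorphism of $A$ if $a_{\sigma(s),\sigma(t)} = a_{s,t}$ for all $s,t\in[n]$; $A$ is vertex-transitive if its group of automorphisms is transitive on $[n]$ (for all $s,t$ there is an automorphism $\sigma$ with $\sigma(s)=t$). $\|A\| = \sup_{x,y\in\mathbb{R}^n,\ |x|,|y|\le 1} |x^* A y|$ is the spectral norm (largest singular value), with $|\cdot|$ the Euclidean norm. The Grothendieck norm is $\|A\|_{\mathsf G} = \sup \left|\sum_{s,t\in[n]} a_{st}\langle x_s, y_t\rangle\right|$, the supremum over all real Hilbert spaces $\mathbb{H}$ and all vectors $x_1,\dots,x_n,y_1,\dots,y_n$ in the closed unit ball of $\mathbb{H}$ (equivalently, one may take $\mathbb{H}=\mathbb{R}^{2n}$). *)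

(* Defs.v *)
From mathcomp Require Import all_boot all_order all_fingroup all_algebra.
From mathcomp Require Import all_classical all_reals all_analysis.

Set Implicit Arguments.
Unset Strict Implicit.
Unset Printing Implicit Defensive.

Import Order.TTheory GRing.Theory Num.Theory.
Import numFieldNormedType.Exports.

Local Open Scope classical_set_scope.
Local Open Scope ring_scope.

Record hilbertSpace (R : realType) := HilbertSpace {
  hilbert_sort :> completeNormedModType R ;
  inner : {dot hilbert_sort for (@idfun R)} ;
  inner_norm : forall x : hilbert_sort, inner x x = `|x| ^+ 2 }.

Definition is_automorphism (R : realType) (n : nat) (A : 'M[R]_n)
    (sigma : 'S_n) : Prop :=
  forall s t : 'I_n, A (sigma s) (sigma t) = A s t.

Definition vertex_transitive (R : realType) (n : nat) (A : 'M[R]_n) : Prop :=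
  forall s t : 'I_n, exists sigma : 'S_n,
    is_automorphism A sigma /\ sigma s = t.

(* The norm `|x| on 'cV[R]_n provided by the library is the sup norm, hence
   this separate definition. *)
Definition euclidean_norm (R : realType) (n : nat) (x : 'cV[R]_n) : R :=
  Num.sqrt (\sum_(i < n) x i 0 ^+ 2).

(* Both norms below are suprema in \bar R, where every set has a genuine
   supremum; the real-valued sup returns 0 on unbounded sets. *)
Definition spectral_norm (R : realType) (n : nat) (A : 'M[R]_n) : \bar R :=
  ereal_sup [set r | exists x y : 'cV[R]_n,
    [/\ euclidean_norm x <= 1, euclidean_norm y <= 1 &
        r = `|(x^T *m A *m y) 0 0|%:E]].

Definition grothendieck_norm (R : realType) (n : nat) (A : 'M[R]_n) : \bar R :=
  ereal_sup [set r | exists (H : hilbertSpace R) (x y : 'I_n -> H),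
    [/\ forall s, `|x s| <= 1, forall t, `|y t| <= 1 &
        r = `|\sum_(s < n) \sum_(t < n) A s t * inner H (x s) (y t)|%:E]].

(* Main.v *)
(* Upper bound: if |u^T A v| <= M on unit vectors, then the quadratic form
   M |u|^2 - 2 u^T A v + M |v|^2 is positive semidefinite, and a positive
   semidefinite form stays nonnegative when products of coordinates are
   replaced by inner products of vectors of a Hilbert space. For vectors in the
   unit ball this gives sum a_st <x_s, y_t> <= n M.
   Lower bound: given x and y in the unit ball of R^n, let x_s be the vector of
   all x_(g s), g ranging over the automorphism group G, scaled by
   (n / |G|)^(1/2). By transitivity x_s has the norm of x, and by invariance
   sum a_st <x_s, y_t> = n x^T A y. *)
Require Import Defs.
From HB Require Import structures.
From mathcomp Require Import all_boot all_order all_fingroup all_algebra.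
From mathcomp Require Import all_classical all_reals all_analysis.
From mathcomp Require Import ring lra.
Import Order.TTheory GRing.Theory Num.Theory.
Import numFieldNormedType.Exports.

Local Open Scope ring_scope.

(** * Euclidean structure on the real functions on a finite set *)

Definition l2 (R : realType) (I : finType) : Type := {ffun I -> R}.

HB.instance Definition _ (R : realType) (I : finType) :=
  GRing.Lmodule.copy (l2 R I) {ffun I -> R}.

Definition l2_dot {R : realType} {I : finType} (x y : l2 R I) : R :=
  \sum_i x i * y i.

Definition l2_norm {R : realType} {I : finType} (x : l2 R I) : R :=
  Num.sqrt (l2_dot x x).

Lemma l2_dot_ge0 {R : realType} {I : finType} (x : l2 R I) :
  0 <= l2_dot x x.
Proof. by apply: sumr_ge0 => i _; rewrite -expr2 sqr_ge0. Qed.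

Lemma l2_normE {R : realType} {I : finType} (x : l2 R I) :
  l2_norm x ^+ 2 = l2_dot x x.
Proof. by rewrite sqr_sqrtr ?l2_dot_ge0. Qed.

Lemma l2_norm_eq0 {R : realType} {I : finType} (x : l2 R I) :
  l2_norm x = 0 -> x = 0.
Proof.
move=> x0; have := l2_normE x; rewrite x0 expr0n /= => /esym/eqP.
rewrite psumr_eq0; last by move=> i _; rewrite -expr2 sqr_ge0.
move=> /allP h; apply/ffunP => i.
have := h i (mem_index_enum i); rewrite /= mulf_eq0 orbb => /eqP ->.
by rewrite ffunE.
Qed.

Lemma l2_dot0l {R : realType} {I : finType} (y : l2 R I) : l2_dot 0 y = 0.
Proof. by rewrite /l2_dot big1// => i _; rewrite ffunE mul0r. Qed.

Lemma l2_dotC {R : realType} {I : finType} (x y : l2 R I) :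
  l2_dot x y = l2_dot y x.
Proof. by apply: eq_bigr => i _; rewrite mulrC. Qed.

Lemma l2_dotP {R : realType} {I : finType} (a : R) (x y z : l2 R I) :
  l2_dot (a *: x + y) z = a * l2_dot x z + l2_dot y z.
Proof.
rewrite /l2_dot mulr_sumr -big_split/=; apply: eq_bigr => i _.
by rewrite !ffunE /GRing.scale/=; ring.
Qed.

Lemma l2_dotPr {R : realType} {I : finType} (a : R) (x y z : l2 R I) :
  l2_dot z (a *: x + y) = a * l2_dot z x + l2_dot z y.
Proof. by rewrite l2_dotC l2_dotP !(l2_dotC z). Qed.

(** With [a] and [b] the norms of [x] and [y], expanding the square of the norm of [b *: x - a *: y]
    gives [0 <= 2ab (ab - l2_dot x y)], and [ab] is positive once the zero vectors are set aside. *)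
Lemma l2_cauchy_schwarz {R : realType} {I : finType} (x y : l2 R I) :
  l2_dot x y <= l2_norm x * l2_norm y.
Proof.
set a := l2_norm x; set b := l2_norm y.
have a_ge0 : 0 <= a by exact: sqrtr_ge0.
have b_ge0 : 0 <= b by exact: sqrtr_ge0.
have [/l2_norm_eq0 ->|a0] := eqVneq a 0; first by rewrite l2_dot0l mulr_ge0.
have [/l2_norm_eq0 ->|b0] := eqVneq b 0.
  by rewrite l2_dotC l2_dot0l mulr_ge0.
have ab_gt0 : 0 < a * b by rewrite mulr_gt0 // lt_neqAle eq_sym ?a0 ?b0.
have := l2_dot_ge0 (b *: x + (- a) *: y + 0).
rewrite addr0 l2_dotP l2_dotPr -[(- a) *: y]addr0 l2_dotP !l2_dotPr.
rewrite !(l2_dotC _ 0) !l2_dot0l -!l2_normE -/a -/b (l2_dotC y x).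
move=> h; rewrite -(ler_pM2l ab_gt0).
nra.
Qed.

Lemma ler_l2_normD {R : realType} {I : finType} (x y : l2 R I) :
  l2_norm (x + y) <= l2_norm x + l2_norm y.
Proof.
rewrite -ler_sqr ?nnegrE ?addr_ge0 ?sqrtr_ge0// l2_normE.
rewrite -[x]scale1r l2_dotP !l2_dotPr scale1r !mul1r sqrrD !l2_normE.
rewrite (l2_dotC y x).
have := l2_cauchy_schwarz x y; lra.
Qed.

Lemma l2_normZ {R : realType} {I : finType} (l : R) (x : l2 R I) :
  l2_norm (l *: x) = `|l| * l2_norm x.
Proof.
rewrite /l2_norm -[l *: x]addr0 l2_dotP l2_dotPr !(l2_dotC _ 0) !l2_dot0l.
by rewrite !addr0 mulrA -expr2 sqrtrM ?sqr_ge0// sqrtr_sqr.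
Qed.

HB.instance Definition _ (R : realType) (I : finType) :=
  Lmodule_isNormed.Build R (l2 R I) (ler_l2_normD) (l2_normZ)
    (l2_norm_eq0).

(** * Completeness of [l2] *)

Lemma l2_coord_le {R : realType} {I : finType} (x : l2 R I) (i : I) :
  `|x i| <= `|x|.
Proof.
rewrite -[X in _ <= X]/(l2_norm x) -sqrtr_sqr ler_sqrt ?l2_dot_ge0//.
rewrite /l2_dot (bigD1 i)//= expr2 lerDl.
by apply: sumr_ge0 => j _; rewrite -expr2 sqr_ge0.
Qed.

Lemma l2_norm_le_sum {R : realType} {I : finType} (x : l2 R I) :
  `|x| <= \sum_i `|x i|.
Proof.
have s0 : 0 <= \sum_i `|x i| by exact: sumr_ge0.
rewrite -[X in X <= _]/(l2_norm x) -ler_sqr ?nnegrE ?sqrtr_ge0//.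
rewrite l2_normE expr2 mulr_suml; apply: ler_sum => i _.
rewrite -expr2 -real_normK ?num_real// expr2 ler_wpM2l// (bigD1 i)//= lerDl.
exact: sumr_ge0.
Qed.

Section completeness.
Local Open Scope classical_set_scope.

(** Coordinates are 1-Lipschitz, so each one converges in [R]. As [I] is finite, the bound of the
    norm by the sum of the coordinates turns this into convergence in norm. *)
Lemma l2_complete {R : realType} {I : finType} (F : set_system (l2 R I)) :
  ProperFilter F -> cauchy F -> cvg F.
Proof.
move=> FF /cauchy_ballP Fc.
have cvF i : cvg ((fun x : l2 R I => x i) @ F).
  apply: cauchy_cvg; apply/cauchy_ballP => e e0.
  rewrite !near_simpl.
  have := Fc e e0; apply: filterS => -[x y] /=.
  rewrite -!ball_normE /= => h; apply: le_lt_trans h.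
  by have := l2_coord_le (x - y) i; rewrite !ffunE.
apply/cvg_ex.
exists ([ffun i => lim ((fun x : l2 R I => x i) @ F)] : l2 R I).
apply/cvgrPdist_lt => e e0.
(* The [+ 1] keeps the denominator positive for empty [I] and makes the sum of the [#|I|] errors
   strictly less than [e]. *)
have d0 : 0 < e / (#|I|%:R + 1) by rewrite divr_gt0// ltr_wpDl.
have : F [set x : l2 R I | forall i,
    `|lim ((fun x : l2 R I => x i) @ F) - x i| < e / (#|I|%:R + 1)].
  apply: filter_forall => i.
  by have /cvgrPdist_lt/(_ _ d0) := cvF i.
apply: filterS => x hx.
apply: (le_lt_trans (l2_norm_le_sum _)).
apply: (@le_lt_trans _ _ (\sum_(i : I) e / (#|I|%:R + 1))).
  by apply: ler_sum => i _; rewrite !ffunE ltW.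
rewrite sumr_const -[X in X < _]mulr_natl mulrCA gtr_pMr//.
by rewrite ltr_pdivrMr ?ltr_wpDl// mul1r ltrDl.
Qed.

End completeness.

HB.instance Definition _ (R : realType) (I : finType) :=
  Uniform_isComplete.Build (l2 R I) (l2_complete).

(** * [l2] as a Hilbert space *)

Lemma l2_dot_linearl {R : realType} {I : finType} (y : l2 R I) :
  linear_for *%R (l2_dot ^~ y).
Proof. by move=> a x z; rewrite l2_dotP. Qed.

Lemma l2_dot_linearr {R : realType} {I : finType} (x : l2 R I) :
  linear_for *%R (l2_dot x).
Proof. by move=> a y z; rewrite l2_dotPr. Qed.

HB.instance Definition _ (R : realType) (I : finType) :=
  @isBilinear.Build R (l2 R I) (l2 R I) R *%R (@idfun R \; *%R) (l2_dot)
    (fun y => zmod_morphism_linear (l2_dot_linearl y))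
    (fun x => zmod_morphism_linear (l2_dot_linearr x))
    (fun y => scalable_linear (l2_dot_linearl y))
    (fun x => scalable_linear (l2_dot_linearr x)).

Lemma l2_dot_hermitian {R : realType} {I : finType} (x y : l2 R I) :
  l2_dot x y = (-1) ^+ false * @idfun R (l2_dot y x).
Proof. by rewrite expr0 mul1r l2_dotC. Qed.

Lemma l2_dot_gt0 {R : realType} {I : finType} (x : l2 R I) :
  x != 0 -> 0 < l2_dot x x.
Proof.
move=> x0; rewrite lt_neqAle l2_dot_ge0 andbT eq_sym -l2_normE sqrf_eq0.
by apply: contraNneq x0 => /l2_norm_eq0 ->.
Qed.

HB.instance Definition _ (R : realType) (I : finType) :=
  @isHermitianSesquilinear.Build R (l2 R I) false (@idfun R) (l2_dot)
    (l2_dot_hermitian).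

HB.instance Definition _ (R : realType) (I : finType) :=
  @isDotProduct.Build R (l2 R I) (l2_dot) (l2_dot_gt0).

Definition l2_hilbert (R : realType) (I : finType) : hilbertSpace R :=
  @HilbertSpace R (l2 R I) (l2_dot) (fun x => esym (l2_normE x)).

(** * Positive semidefinite forms evaluated on Hilbert space vectors *)

Lemma innerC {R : realType} (H : hilbertSpace R) (x y : H) :
  inner H x y = inner H y x.
Proof. by rewrite (@hermitian_subproof _ _ _ _ (inner H) x y) expr0 mul1r. Qed.

(** Linearity in the shape of an orthogonal projection; the values at [0] and at [- x] are read off
    from it. *)
Lemma innerBZl {R : realType} (H : hilbertSpace R) (a : R) (x w y : H) :
  inner H (x - a *: w) y = inner H x y - a * inner H w y.
Proof.
rewrite (@zmod_morphisml_subproof _ _ _ _ _ _ (inner H) y x).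
by rewrite (@linearl_subproof _ _ _ _ _ _ (inner H) y a w).
Qed.

Lemma innerBZr {R : realType} (H : hilbertSpace R) (a : R) (x w y : H) :
  inner H y (x - a *: w) = inner H y x - a * inner H y w.
Proof. by rewrite innerC innerBZl !(innerC H _ y). Qed.

Lemma inner0l {R : realType} (H : hilbertSpace R) (y : H) : inner H 0 y = 0.
Proof.
by rewrite -(subrr (1 *: y)) scale1r -{2}[y]scale1r innerBZl mul1r subrr.
Qed.

(* Induction on the number of nonzero vectors: projecting the family onto the
   orthogonal complement of one of its members kills that member, and splits
   the Gram matrix into the Gram matrix of the projections and a rank-one
   matrix. *)
Lemma psd_sum_inner_ge0 {R : realType} (H : hilbertSpace R) (I : finType)
    (B : I -> I -> R) (z : I -> H) :
  (forall c : I -> R, 0 <= \sum_i \sum_j B i j * (c i * c j)) ->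
  0 <= \sum_i \sum_j B i j * inner H (z i) (z j).
Proof.
move=> B_psd; move: {2}#|_| (leqnn #|[pred i | z i != 0]|) => k.
elim: k z => [|k IHk] z zk.
  rewrite big1// => i _; rewrite big1// => j _.
  have := card0_eq (eqP (etrans (esym (leqn0 _)) zk)) i.
  by rewrite !inE => /negbFE/eqP ->; rewrite inner0l mulr0.
have [i0 zi0|z0] := pickP [pred i | z i != 0]; last first.
  by apply: IHk; rewrite (eq_card0 z0).
set w := z i0; pose a i := inner H (z i) w / `|w| ^+ 2.
have w2 : `|w| ^+ 2 != 0 by rewrite sqrf_eq0 normr_eq0.
pose z' i := z i - a i *: w.
(* The last summand is the form at the real vector [c i = |w| a i], so its total is nonnegative by
   [B_psd]. *)
have zE i j : B i j * inner H (z i) (z j) =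
    B i j * inner H (z' i) (z' j) + B i j * ((`|w| * a i) * (`|w| * a j)).
  rewrite -mulrDr; congr (_ * _).
  rewrite innerBZl !innerBZr inner_norm (innerC _ w).
  have aE l : inner H (z l) w = a l * `|w| ^+ 2 by rewrite /a divfK.
  rewrite !aE; ring.
under eq_bigr => i _ do under eq_bigr => j _ do rewrite zE.
under eq_bigr => i _ do rewrite big_split/=.
rewrite big_split/= addr_ge0 ?B_psd//; apply: IHk.
(* Zero vectors stay zero under the projection and [z i0] becomes zero, so the number of nonzero
   vectors drops. *)
rewrite -ltnS; apply: leq_trans zk; apply: proper_card.
apply/properP; split.
  apply/fintype.subsetP => i; rewrite !inE; apply: contraNN => /eqP zi.
  by rewrite /z' /a zi inner0l mul0r scale0r subr0.
exists i0 => //; rewrite !inE negbK /z' /a -/w inner_norm divff//.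
by rewrite scale1r subrr.
Qed.

(** * Bilinear forms of matrices and the upper bound *)

Lemma euclidean_norm_ge0 {R : realType} {n : nat} (x : 'cV[R]_n) :
  0 <= euclidean_norm x.
Proof. exact: sqrtr_ge0. Qed.

Lemma euclidean_normE {R : realType} {n : nat} (x : 'cV[R]_n) :
  euclidean_norm x ^+ 2 = \sum_i x i 0 ^+ 2.
Proof. by rewrite sqr_sqrtr// sumr_ge0// => i _; exact: sqr_ge0. Qed.

Lemma euclidean_normZ {R : realType} {n : nat} (a : R) (x : 'cV[R]_n) :
  euclidean_norm (a *: x) = `|a| * euclidean_norm x.
Proof.
rewrite /euclidean_norm -sqrtr_sqr -sqrtrM ?sqr_ge0// mulr_sumr.
by congr Num.sqrt; apply: eq_bigr => i _; rewrite mxE exprMn.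
Qed.

Lemma euclidean_norm0 {R : realType} (n : nat) :
  euclidean_norm (0 : 'cV[R]_n) = 0.
Proof. by rewrite -(scale0r (0 : 'cV[R]_n)) euclidean_normZ normr0 mul0r. Qed.

Lemma euclidean_norm0_le1 {R : realType} (n : nat) :
  euclidean_norm (0 : 'cV[R]_n) <= 1.
Proof. by rewrite euclidean_norm0. Qed.

Lemma euclidean_norm_eq0 {R : realType} {n : nat} (x : 'cV[R]_n) :
  euclidean_norm x = 0 -> x = 0.
Proof.
move=> x0; have := euclidean_normE x; rewrite x0 expr0n /= => /esym/eqP.
rewrite psumr_eq0; last by move=> i _; exact: sqr_ge0.
move=> /allP h; apply/colP => i.
have := h i (mem_index_enum i); rewrite /= sqrf_eq0 => /eqP ->.
by rewrite mxE.
Qed.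

Lemma bilinear_mxE {R : realType} {n : nat} (A : 'M[R]_n) (x y : 'cV[R]_n) :
  (x^T *m A *m y) 0 0 = \sum_s \sum_t A s t * (x s 0 * y t 0).
Proof.
rewrite mxE exchange_big/=; apply: eq_bigr => t _.
by rewrite mxE mulr_suml; apply: eq_bigr => s _; rewrite mxE; ring.
Qed.

(** Homogeneity: nonzero vectors are normalized, and both sides vanish if one vector is zero. *)
Lemma bilinear_mx_le {R : realType} {n : nat} (A : 'M[R]_n) (M : R) :
  (forall x y : 'cV[R]_n, euclidean_norm x <= 1 -> euclidean_norm y <= 1 ->
    `|(x^T *m A *m y) 0 0| <= M) ->
  forall x y : 'cV[R]_n,
    (x^T *m A *m y) 0 0 <= M * (euclidean_norm x * euclidean_norm y).
Proof.
move=> AM x y.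
have [/euclidean_norm_eq0 ->|x0] := eqVneq (euclidean_norm x) 0.
  by rewrite trmx0 !mul0mx mxE euclidean_norm0 mul0r mulr0.
have [/euclidean_norm_eq0 ->|y0] := eqVneq (euclidean_norm y) 0.
  by rewrite mulmx0 mxE euclidean_norm0 !mulr0.
have unit (v : 'cV[R]_n) : euclidean_norm v != 0 ->
    euclidean_norm ((euclidean_norm v)^-1 *: v) <= 1.
  move=> v0; rewrite euclidean_normZ ger0_norm ?invr_ge0 ?euclidean_norm_ge0//.
  by rewrite mulVf.
have := AM _ _ (unit x x0) (unit y y0).
move=> /(le_trans (ler_norm _)).
rewrite [( _ *: x)^T]linearZ/= -!scalemxAl -scalemxAr scalerA mxE -invfM mulrC.
rewrite ler_pdivrMr//.
by rewrite mulr_gt0// lt_neqAle eq_sym ?x0 ?y0 euclidean_norm_ge0.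
Qed.

Lemma sum_inner_le {R : realType} (H : hilbertSpace R) {n : nat}
    (A : 'M[R]_n) (M : R) (x y : 'I_n -> H) :
  (forall u v : 'cV[R]_n, euclidean_norm u <= 1 -> euclidean_norm v <= 1 ->
    `|(u^T *m A *m v) 0 0| <= M) ->
  2 * \sum_s \sum_t A s t * inner H (x s) (y t) <=
    M * (\sum_s `|x s| ^+ 2 + \sum_t `|y t| ^+ 2).
Proof.
move=> AM.
have M0 : 0 <= M.
  apply: le_trans (normr_ge0 _) (AM 0 0 _ _); exact: euclidean_norm0_le1.
(* The matrix of [M |u|^2 - 2 u^T A v + M |v|^2] on pairs [(u, v)]. A quadratic form only sees the
   sum of an entry and its mirror image, so one block carries the whole cross term. *)
pose B (i j : 'I_n + 'I_n) : R := match i, j with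
  | inl s, inl s' => M *+ (s == s')
  | inr t, inr t' => M *+ (t == t')
  | inl s, inr t => - (2 * A s t)
  | inr _, inl _ => 0 end.
(* [F] is arbitrary to cover both products of real coordinates and inner products. *)
have BE (F : 'I_n + 'I_n -> 'I_n + 'I_n -> R) :
    \sum_i \sum_j B i j * F i j =
    M * (\sum_s F (inl s) (inl s) + \sum_t F (inr t) (inr t))
    - 2 * \sum_s \sum_t A s t * F (inl s) (inr t).
  have diag (G : 'I_n -> 'I_n -> R) s :
      \sum_t M *+ (s == t) * G s t = M * G s s.
    rewrite (bigD1 s)//= eqxx big1 ?addr0// => t /negbTE.
    by rewrite eq_sym => ->; rewrite mul0r.
  rewrite big_sumType/=.
  under eq_bigr => s _ do rewrite
    big_sumType/= (diag (fun s t => F (inl s) (inl t))).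
  rewrite [X in _ + X](eq_bigr (fun t => M * F (inr t) (inr t))); last first.
    move=> t _; rewrite big_sumType/= (diag (fun s t => F (inr s) (inr t))).
    by rewrite big1 ?add0r// => s _; rewrite mul0r.
  rewrite big_split/= -!mulr_sumr.
  rewrite [X in _ + X + _](eq_bigr
    (fun s => - 2 * \sum_t A s t * F (inl s) (inr t))); last first.
    by move=> s _; rewrite mulr_sumr; apply: eq_bigr => t _; ring.
  rewrite -mulr_sumr.
  ring.
have B_psd c : 0 <= \sum_i \sum_j B i j * (c i * c j).
  rewrite (BE (fun i j => c i * c j)).
  pose u : 'cV[R]_n := \col_s c (inl s); pose v : 'cV[R]_n := \col_t c (inr t).
  have := bilinear_mx_le A M AM u v; rewrite bilinear_mxE.
  have -> : \sum_s c (inl s) * c (inl s) = euclidean_norm u ^+ 2.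
    by rewrite euclidean_normE; apply: eq_bigr => s _; rewrite mxE expr2.
  have -> : \sum_t c (inr t) * c (inr t) = euclidean_norm v ^+ 2.
    by rewrite euclidean_normE; apply: eq_bigr => s _; rewrite mxE expr2.
  under eq_bigr => s _ do under eq_bigr => t _ do rewrite !mxE.
  (* This gives [M |u|^2 + M |v|^2 >= 2 M |u| |v|], which dominates [2 u^T A v]. *)
  have := mulr_ge0 M0 (sqr_ge0 (euclidean_norm u - euclidean_norm v)).
  move: (\sum_s _) => S; lra.
pose z i := match i with inl s => x s | inr t => y t end.
have := psd_sum_inner_ge0 H _ B z B_psd.
rewrite (BE (fun i j => inner H (z i) (z j)))/= subr_ge0 => /le_trans; apply.
rewrite (eq_bigr (fun s => `|x s| ^+ 2)) => [|s _]; last exact: inner_norm.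
rewrite [X in _ + X](eq_bigr (fun t => `|y t| ^+ 2)) => // t _.
exact: inner_norm.
Qed.

Lemma norm_sum_inner_le {R : realType} (H : hilbertSpace R) {n : nat}
    (A : 'M[R]_n) (M : R) (x y : 'I_n -> H) :
  (forall u v : 'cV[R]_n, euclidean_norm u <= 1 -> euclidean_norm v <= 1 ->
    `|(u^T *m A *m v) 0 0| <= M) ->
  (forall s, `|x s| <= 1) -> (forall t, `|y t| <= 1) ->
  `|\sum_s \sum_t A s t * inner H (x s) (y t)| <= n%:R * M.
Proof.
move=> AM x1 y1.
have sq1 (v : 'I_n -> H) :
    (forall s, `|v s| <= 1) -> \sum_s `|v s| ^+ 2 <= n%:R.
  move=> v1; apply: (@le_trans _ _ (\sum_(s < n) 1)).
    by apply: ler_sum => s _; exact: exprn_ile1.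
  by rewrite sumr_const card_ord.
have half (w : 'I_n -> H) : (forall s, `|w s| <= 1) ->
    \sum_s \sum_t A s t * inner H (w s) (y t) <= n%:R * M.
  move=> w1; have := sum_inner_le H A M w y AM.
  have M0 : 0 <= M.
    apply: le_trans (normr_ge0 _) (AM 0 0 _ _); exact: euclidean_norm0_le1.
  have := ler_wpM2l M0 (lerD (sq1 w w1) (sq1 y y1)).
  move: (\sum_s \sum_t _) => S; lra.
(* The bound from below is the bound from above for the family [- x s]. *)
rewrite ler_norml half// andbT lerNl -sumrN.
have := half (fun s => - x s); under eq_bigr => s _.
  under eq_bigr => t _.
    rewrite -[- x s]add0r -[x s]scale1r innerBZl inner0l sub0r mul1r mulrN.
    over.
  rewrite sumrN; over.
by apply => s; rewrite normrN.
Qed.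

(** * Averaging over the automorphism group *)

Definition autb {R : realType} {n : nat} (A : 'M[R]_n) : pred 'S_n :=
  fun g => [forall s, forall t, A (g s) (g t) == A s t].

Lemma autbP {R : realType} {n : nat} (A : 'M[R]_n) (g : 'S_n) :
  reflect (is_automorphism A g) (autb A g).
Proof.
apply: (iffP forallP) => [h s t|h s]; first by have /forallP/(_ t)/eqP := h s.
by apply/forallP => t; apply/eqP.
Qed.

(** Allows sums over the automorphisms to be reindexed by left multiplication. *)
Lemma autbM {R : realType} {n : nat} (A : 'M[R]_n) (h g : 'S_n) :
  is_automorphism A h -> autb A (h * g)%g = autb A g.
Proof.
move=> Ah; apply/autbP/autbP => Ag s t; last by rewrite !permM Ag Ah.
have := Ag (h^-1%g s) (h^-1%g t); rewrite !permM !permKV => ->.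
by rewrite -Ah !permKV.
Qed.

Lemma card_autb_gt0 {R : realType} {n : nat} (A : 'M[R]_n) :
  (0 < #|autb A|)%N.
Proof. by apply/card_gt0P; exists 1%g; apply/autbP => s t; rewrite !perm1. Qed.

(** Reindexing by an automorphism that maps [s] to [t] shows that the sum over [g] is the same at
    every vertex. Summing it over all vertices and exchanging the sums, each [g] contributes the
    full sum of [F]. *)
Lemma sum_autb_transitive {R : realType} {n : nat} (A : 'M[R]_n) (F : 'I_n -> R)
    (s : 'I_n) : vertex_transitive A ->
  n%:R * \sum_(g | autb A g) F (g s) = #|autb A|%:R * \sum_t F t.
Proof.
move=> hA.
have const t : \sum_(g | autb A g) F (g t) = \sum_(g | autb A g) F (g s).
  have [h [Ah hs]] := hA s t.
  rewrite [RHS](reindex_inj (mulgI h)); apply: eq_big => [g|g _].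
    by rewrite autbM.
  by rewrite permM hs.
transitivity (\sum_t \sum_(g | autb A g) F (g t)).
  by rewrite (eq_bigr _ (fun t _ => const t)) sumr_const card_ord mulr_natl.
rewrite exchange_big/= (eq_bigr (fun=> \sum_t F t)).
  by rewrite sumr_const mulr_natl.
by move=> g _; rewrite [RHS](reindex_inj (@perm_inj _ g)).
Qed.

(* The scaling makes the lift of [x] at every vertex a vector of the same norm
   as [x]. *)
Definition orbit_lift {R : realType} {n : nat} (A : 'M[R]_n) (x : 'cV[R]_n)
    (s : 'I_n) : l2 R 'S_n :=
  [ffun g => if autb A g
    then Num.sqrt (n%:R / #|autb A|%:R) * x (g s) 0 else 0].

Lemma orbit_lift_dot {R : realType} {n : nat} (A : 'M[R]_n) (x y : 'cV[R]_n)
    (s t : 'I_n) :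
  l2_dot (orbit_lift A x s) (orbit_lift A y t) =
  n%:R / #|autb A|%:R * \sum_(g | autb A g) x (g s) 0 * y (g t) 0.
Proof.
rewrite /l2_dot [in RHS]big_mkcond mulr_sumr; apply: eq_bigr => g _.
rewrite !ffunE; case: ifP => _; last by rewrite !mulr0.
have c0 : 0 <= n%:R / #|autb A|%:R :> R by rewrite divr_ge0.
by rewrite -[in RHS](sqr_sqrtr c0); ring.
Qed.

Lemma orbit_lift_norm {R : realType} {n : nat} (A : 'M[R]_n) (x : 'cV[R]_n)
    (s : 'I_n) :
  vertex_transitive A -> `|orbit_lift A x s| = euclidean_norm x.
Proof.
move=> hA; congr Num.sqrt; rewrite orbit_lift_dot mulrAC.
under eq_bigr do rewrite -expr2.
rewrite (sum_autb_transitive A (fun t => x t 0 ^+ 2))// mulrAC divff ?mul1r//.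
by rewrite pnatr_eq0 -lt0n card_autb_gt0.
Qed.

(** For each automorphism [g], reindexing rows and columns by [g] turns its contribution into
    [x^T A y]; the number of automorphisms cancels the denominator of the scaling. *)
Lemma orbit_lift_sum {R : realType} {n : nat} (A : 'M[R]_n) (x y : 'cV[R]_n) :
  \sum_s \sum_t A s t * l2_dot (orbit_lift A x s) (orbit_lift A y t) =
  n%:R * (x^T *m A *m y) 0 0.
Proof.
set c : R := n%:R / #|autb A|%:R.
transitivity (c * \sum_(g | autb A g) \sum_s \sum_t
    A s t * (x (g s) 0 * y (g t) 0)).
  rewrite [in RHS]exchange_big/= mulr_sumr; apply: eq_bigr => s _.
  rewrite [in RHS]exchange_big/= mulr_sumr; apply: eq_bigr => t _.
  by rewrite orbit_lift_dot -/c mulrCA -mulr_sumr.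
rewrite (eq_bigr (fun=> (x^T *m A *m y) 0 0)) => [|g /autbP Ag].
  rewrite sumr_const -[X in c * X]mulr_natl mulrA divfK//.
  by rewrite pnatr_eq0 -lt0n card_autb_gt0.
rewrite bilinear_mxE [RHS](reindex_inj (@perm_inj _ g)); apply: eq_bigr => s _.
rewrite [RHS](reindex_inj (@perm_inj _ g)); apply: eq_bigr => t _.
by rewrite Ag.
Qed.

(** * Equality of the norms in the extended reals *)

Theorem theorem2p2 (R : realType) (n : nat) (A : 'M[R]_n)
    (hA : vertex_transitive A) :
  grothendieck_norm A = (n%:R%:E * spectral_norm A)%E.
Proof.
apply/eqP; rewrite eq_le; apply/andP; split.
  apply: ge_ereal_sup => _ [H [x [y [x1 y1 ->]]]].
  have spec u v : euclidean_norm u <= 1 -> euclidean_norm v <= 1 ->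
      (`|(u^T *m A *m v) 0 0|%:E <= spectral_norm A)%E.
    by move=> u1 v1; apply: ereal_sup_ubound; exists u, v.
  case: (spectral_norm A) spec => [M| |] spec.
  - rewrite -EFinM lee_fin; exact: norm_sum_inner_le.
  (* Since [0 * +oo = 0], dimension zero is separate: there the sum is empty. Otherwise the right
     side is [+oo]. *)
  - case: n A hA x y x1 y1 spec => [|n] A hA x y x1 y1 _.
      by rewrite mul0e big_ord0 normr0.
    by rewrite mulry gtr0_sg// mul1e leey.
  - by have := spec 0 0 (euclidean_norm0_le1 _) (euclidean_norm0_le1 _).
(* The factor [n] moves inside the supremum of a nonempty set; the zero vectors provide an
   element. *)
rewrite -ereal_supZl//; last first.
  apply/set0P; exists `|((0 : 'cV[R]_n)^T *m A *m (0 : 'cV[R]_n)) 0 0|%:E.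
  by exists 0, 0; split => //; exact: euclidean_norm0_le1.
apply: ge_ereal_sup => _ [_ [x [y [x1 y1 ->]]] <-].
apply: ereal_sup_ubound.
exists (l2_hilbert R 'S_n), (orbit_lift A x), (orbit_lift A y); split.
- by move=> s; rewrite /= orbit_lift_norm.
- by move=> t; rewrite /= orbit_lift_norm.
- by rewrite /= orbit_lift_sum normrM ger0_norm.
Qed.
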